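(* Let $T=\{3,6\}/\Gamma$ be a polyhedral equivelar triangulated torus with $n$ vertices, $G=\mathbb T/\Gamma$, and let $M\subseteq M'$ be the lattices of the context. Let $d$ be the first elementary divisor of $G$, so $d=\gcd(n/|\tau_i|,n/|\tau_j|)$ for $i\neq j$. Then there is an extension $$1\to G^*\to(M'/M)^*\to G^*\times(\mathbb Z_d)^*\to1 .$$ In particular $|M'/M|=n^2d$.
   Context: Let $\mathbb T\subset\mathbb R^2$ be the lattice generated by $\tau_1=(1,0)$, $\tau_2=\frac12(-1,\sqrt3)$, $\tau_3=\frac12(-1,-\sqrt3)$ (so $\tau_1+\tau_2+\tau_3=0$). $\{3,6\}$ is the tessellation of $\mathbb R^2$ by equilateral triangles with vertex set $\mathbb T$ and edges $\{p,p+\tau_k\}$. Let $\Gamma\subseteq\mathbb T$ be a sublattice of index $n$, $T=\{3,6\}/\Gamma$. $T$ is assumed polyhedral: the intersection of two triangles is a common face. $G=\mathbb T/\Gamma$ acts simply transitively on $\mathrm{vert}\,T$ by translations; $\pm\tau_k(p)$ means $p\pm\tau_k$; $|\tau_k|$ is the order of $\tau_k$ in $G$. Convention: $\{i,j,k\}=\{1,2,3\}$. For an abelian group $H$, $H^*=\mathrm{Hom}(H,\mathbb C^* )$. Let $\epsilon_1,\epsilon_2,\epsilon_3$ and $e_p$ ($p\in\mathrm{vert}\,T$) be the standard basis of $\mathbb Z^3\oplus\mathbb Z^n$. $M'=\mathbb Z^3\oplus\{(a_p)\in\mathbb Z^n:\sum a_p=0\}$, and $M\subseteq M'$ is the sublattice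 (of finite index) generated by the $3n$ vectors $$A_{p,\tau_k(p)}=\epsilon_k+e_p+e_{\tau_k(p)}-e_{-\tau_i(p)}-e_{-\tau_j(p)},\quad p\in\mathrm{vert}\,T,\ k=1,2,3.$$ *)

(* Defs.v *)
From HB Require Import structures.
From mathcomp Require Import all_boot all_order all_algebra all_fingroup.
From mathcomp Require Import finmap mathcomp_extra boolp classical_sets cardinality.
From mathcomp Require Import reals.
From mathcomp Require Import complex.

Set Implicit Arguments.
Unset Strict Implicit.
Unset Printing Implicit Defensive.

Import Order.TTheory GRing.Theory Num.Theory.

Local Open Scope classical_set_scope.
Local Open Scope ring_scope.

Section Lattice.
Variable R : realType.

Definition vec2 (a b : R) : 'rV[R]_2 := \row_j (if j == 0 then a else b).

(* The indices 0, 1, 2 : 'I_3 stand for the subscripts 1, 2, 3. *)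
Definition tau_vec (k : 'I_3) : 'rV[R]_2 :=
  match val k with
  | 0%N => vec2 1 0
  | 1%N => 2^-1 *: vec2 (-1) (Num.sqrt 3)
  | _ => 2^-1 *: vec2 (-1) (- Num.sqrt 3)
  end.

Definition lattice_pred : {pred 'rV[R]_2} :=
  [pred x | `[< exists c : 'I_3 -> int, x = \sum_k tau_vec k *~ c k >]].

Lemma lattice_pred_zmod_closed : zmod_closed lattice_pred.
Proof.
split=> [|x y].
  apply/asboolP; exists (fun=> 0); rewrite big1//.
move=> /asboolP[c ->] /asboolP[c' ->]; apply/asboolP.
exists (fun k => c k - c' k); rewrite -sumrB; apply: eq_bigr => k _.
by rewrite mulrzBr.
Qed.

HB.instance Definition _ :=
  GRing.isZmodClosed.Build _ lattice_pred lattice_pred_zmod_closed.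

Record lattice := Lattice { pt :> 'rV[R]_2; pt_lattice : pt \in lattice_pred }.

HB.instance Definition _ := [isSub for pt].
HB.instance Definition _ := [Choice of lattice by <:].
HB.instance Definition _ := [SubChoice_isSubZmodule of lattice by <:].

Lemma tau_lattice k : tau_vec k \in lattice_pred.
Proof.
apply/asboolP; exists (fun i => (i == k)%:R).
rewrite (bigD1 k)//= eqxx mulr1z big1 ?addr0// => i /negPf ->.
exact: mulr0z.
Qed.

Definition tau (k : 'I_3) : lattice := Lattice (tau_lattice k).

Definition adjacent (p q : lattice) : Prop :=
  exists k, q = p + tau k \/ p = q + tau k.

(* The triangles of {3,6}, given by their vertices: the 3-cycles of its edge
   graph. *)
Definition is_triangle (s : seq lattice) : Prop :=
  exists p q r, [/\ s = [:: p; q; r], adjacent p q, adjacent q r & adjacent p r].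

(* The hull of the empty sequence is the empty set. *)
Definition hull (s : seq lattice) : set 'rV[R]_2 :=
  [set x | exists w : 'I_(size s) -> R,
     [/\ forall i, 0 <= w i, \sum_i w i = 1
       & x = \sum_i w i *: pt (s`_i)]].

Record sublattice := Sublattice {
  sublattice_set :> zmodClosed lattice;
  sublattice_index : finite_set (@setT (Quotient.quot sublattice_set)) }.

(* The closed cell of R^2 / Gamma carried by the simplex with vertices s, as a
   Gamma-invariant subset of R^2. *)
Definition cell (Gamma : sublattice) (s : seq lattice) : set 'rV[R]_2 :=
  [set x | exists g : lattice, g \in Gamma /\ hull s (x - pt g)].

(* A face of a simplex is the hull of a subset of its vertices; it may be
   empty. *)
Definition polyhedral (Gamma : sublattice) : Prop :=
  forall s t, is_triangle s -> is_triangle t ->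
  exists f g, [/\ {subset f <= s}, {subset g <= t},
    cell Gamma s `&` cell Gamma t = cell Gamma f & cell Gamma f = cell Gamma g].

End Lattice.

(* The group G = T / Gamma, identified with the vertex set of {3,6} / Gamma. *)
Definition vert (R : realType) (Gamma : sublattice R) := Quotient.quot Gamma.

Section Vert.
Variables (R : realType) (Gamma : sublattice R).
Local Notation G := (vert Gamma).

HB.instance Definition _ := GRing.Zmodule.on G.

Let vert_enum : seq G := enum_fset (fset_set [set: G]).

Let mem_vert_enum (x : G) : x \in vert_enum.
Proof. by rewrite in_fset_set ?inE//; exact: sublattice_index. Qed.

Let vert_pickleK :
  pcancel (fun x : G => index x vert_enum) (nth None (map some vert_enum)).
Proof.
move=> x; rewrite (nth_map x) ?index_mem ?mem_vert_enum//.
by rewrite nth_index ?mem_vert_enum.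
Qed.

HB.instance Definition _ := Choice_isCountable.Build G vert_pickleK.

Let vert_enumP : Finite.axiom vert_enum.
Proof. by move=> x; rewrite count_uniq_mem ?mem_vert_enum// fset_uniq. Qed.

HB.instance Definition _ := isFinite.Build G vert_enumP.
HB.instance Definition _ := [finGroupMixin of G for +%R].

Definition vtau (k : 'I_3) : G := \pi_G%qT (tau R k).

End Vert.

Section Torus.
Variables (R : realType) (Gamma : sublattice R).
Local Notation G := (vert Gamma).

Definition Z3n := ({ffun 'I_3 -> int} * {ffun G -> int})%type.

Definition epsilon (k : 'I_3) : Z3n := ([ffun i => (i == k)%:R], 0).
Definition e_ (p : G) : Z3n := (0, [ffun q => (q == p)%:R]).

HB.instance Definition _ := GRing.Zmodule.on Z3n.

Definition M'_pred : {pred Z3n} := [pred v : Z3n | \sum_p v.2 p == 0].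

Lemma M'_pred_zmod_closed : zmod_closed M'_pred.
Proof.
split=> [|u v]; rewrite !inE.
  by rewrite big1// => p _; rewrite ffunE.
move=> /eqP u0 /eqP v0; apply/eqP.
transitivity (\sum_p u.2 p - \sum_p v.2 p); last by rewrite u0 v0 subr0.
by rewrite -sumrB; apply: eq_bigr => p _; rewrite !ffunE.
Qed.

HB.instance Definition _ :=
  GRing.isZmodClosed.Build _ M'_pred M'_pred_zmod_closed.

Record M' := MkM' { M'_val :> Z3n; M'_valP : M'_val \in M'_pred }.

HB.instance Definition _ := [isSub for M'_val].
HB.instance Definition _ := [Choice of M' by <:].
HB.instance Definition _ := [SubChoice_isSubZmodule of M' by <:].

(* A_{p, tau_k(p)}; the sum has the two terms i <> k. *)
Definition A_vec (p : G) (k : 'I_3) : Z3n :=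
  epsilon k + e_ p + e_ (p + vtau Gamma k)
  - \sum_(i < 3 | i != k) e_ (p - vtau Gamma i).

Lemma A_M' p k : A_vec p k \in M'_pred.
Proof.
pose s (v : Z3n) := \sum_p v.2 p.
have sD u v : s (u + v) = s u + s v.
  by rewrite /s -big_split; apply: eq_bigr => q _; rewrite ffunE.
have s0 : s 0 = 0 by rewrite /s big1// => q _; rewrite ffunE.
have sN u : s (- u) = - s u.
  by rewrite /s -sumrN; apply: eq_bigr => q _; rewrite ffunE.
have se q : s (e_ q) = 1.
  rewrite /s (bigD1 q)//= ffunE eqxx big1 ?addr0// => r /negPf rq.
  by rewrite ffunE rq.
have sS : s (\sum_(i < 3 | i != k) e_ (p - vtau Gamma i)) = 2.
  rewrite (big_morph s sD s0) (eq_bigr (fun=> 1)) => [|i _]; last exact: se.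
  rewrite big_mkcond !big_ord_recl big_ord0.
  by case: k => -[|[|[|]]].
have sep : s (epsilon k) = 0 by rewrite /s big1// => q _; rewrite ffunE.
rewrite inE; apply/eqP; change (s (A_vec p k) = 0).
by rewrite /A_vec !sD sN sS !se sep.
Qed.

Definition A (p : G) (k : 'I_3) : M' := MkM' (A_M' p k).

Definition M_pred : {pred M'} :=
  [pred v | `[< exists c : G -> 'I_3 -> int, v = \sum_p \sum_k A p k *~ c p k >]].

Lemma M_pred_zmod_closed : zmod_closed M_pred.
Proof.
split=> [|x y].
  apply/asboolP; exists (fun=> fun=> 0); rewrite big1// => p _.
  by rewrite big1// => k _; exact: mulr0z.
move=> /asboolP[c ->] /asboolP[c' ->]; apply/asboolP.
exists (fun p k => c p k - c' p k); rewrite -sumrB; apply: eq_bigr => p _.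
by rewrite -sumrB; apply: eq_bigr => k _; rewrite mulrzBr.
Qed.

HB.instance Definition _ :=
  GRing.isZmodClosed.Build _ M_pred M_pred_zmod_closed.

Definition M'_mod_M := Quotient.quot M_pred.
HB.instance Definition _ := GRing.Zmodule.on M'_mod_M.

End Torus.

Definition Zmod (d : nat) := Quotient.quot (dvdz d%:Z : {pred int}).
HB.instance Definition _ d := GRing.Zmodule.on (Zmod d).

(* G is isomorphic to Z/d x Z/d' with d | d'. *)
Definition first_elementary_divisor (G : finZmodType) (d : nat) : Prop :=
  exists d' : nat, (d %| d')%N /\
    exists f : {additive (Zmod d * Zmod d')%type -> G}, bijective f.

(* Hom(H, C^* ), a group under pointwise multiplication. *)
Record dual (R : realType) (H : zmodType) := Dual {
  dual_fun :> H -> R[i];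
  dual_neq0 : forall x, dual_fun x != 0;
  dualD : forall x y, dual_fun (x + y) = dual_fun x * dual_fun y }.

Section DualGroup.
Variables (R : realType) (H : zmodType).
Local Notation D := (dual R H).
Implicit Types a b : D.

HB.instance Definition _ := gen_eqMixin D.
HB.instance Definition _ := gen_choiceMixin D.

Lemma dualP a b : a =1 b -> a = b.
Proof.
case: a b => [f f0 fD] [g g0 gD] /= /funext fg; case: _ / fg in g0 gD *.
by congr Dual; exact: Prop_irrelevance.
Qed.

Definition dual_one : D.
Proof. by exists (fun=> 1) => [x|x y]; rewrite ?oner_eq0 ?mulr1. Defined.

Definition dual_mul a b : D.
Proof.
exists (fun x => a x * b x) => [x|x y]; first by rewrite mulf_neq0 ?dual_neq0.
by rewrite !dualD mulrACA.
Defined.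

Definition dual_inv a : D.
Proof.
exists (fun x => (a x)^-1) => [x|x y]; first by rewrite invr_eq0 dual_neq0.
by rewrite dualD invfM.
Defined.

Lemma dual_mulA : associative dual_mul.
Proof. by move=> a b c; apply: dualP => x /=; rewrite mulrA. Qed.

Lemma dual_mul1 : left_id dual_one dual_mul.
Proof. by move=> a; apply: dualP => x /=; rewrite mul1r. Qed.

Lemma dual_mulr1 : right_id dual_one dual_mul.
Proof. by move=> a; apply: dualP => x /=; rewrite mulr1. Qed.

Lemma dual_mulV : left_inverse dual_one dual_inv dual_mul.
Proof. by move=> a; apply: dualP => x /=; rewrite mulVf ?dual_neq0. Qed.

Lemma dual_mulrV : right_inverse dual_one dual_inv dual_mul.
Proof. by move=> a; apply: dualP => x /=; rewrite mulfV ?dual_neq0. Qed.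

HB.instance Definition _ := isGroup.Build D
  dual_mulA dual_mul1 dual_mulr1 dual_mulV dual_mulrV.

End DualGroup.

Definition extension (N E Q : groupType) : Prop :=
  exists (f : {multiplicative N -> E}) (g : {multiplicative E -> Q}),
  [/\ injective f,
      forall y : E, g y = 1%g <-> exists x, f x = y
    & forall z : Q, exists y, g y = z].

(* Main.v *)
(* Send the class of (c, a) to sum a_p p - sum c_k A_k, where A_k is the part of
   A_{0, tau_k} in Z[G].  Each A_k is a unit times (tau_i - 1)(tau_j - 1) in
   Z[G], so this identifies M'/M with I/I^3, I being the augmentation ideal.
   Concretely, p |-> e_p - e_0 is the universal quadratic map on G, that is, the
   universal map vanishing at 0 whose third differences vanish.  If
   G = Z/d x Z/d' with d | d' and generators g1, g2, sending a quadratic map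
   G -> C^* to its polarization has kernel G^*.  A symmetric bicharacter is a free
   choice of values at (g1, g1), (g1, g2), (g2, g2), of orders dividing d, d, d',
   so these form G^* x (Z/d)^* and each is a polarization because C^* is
   divisible.  Finally, every element of I/I^3 is uniquely a combination of the
   images of g1, g2 and of the three polarizations with coefficients in
   [0, d), [0, d'), [0, d), [0, d), [0, d'). *)
From HB Require Import structures.
Require Import Defs.
From mathcomp Require Import all_boot all_order all_algebra all_fingroup.
From mathcomp Require Import mathcomp_extra boolp classical_sets functions.
From mathcomp Require Import cardinality.
From mathcomp Require Import reals complex cyclic zify ring.

Set Implicit Arguments.
Unset Strict Implicit.
Unset Printing Implicit Defensive.

Import Order.TTheory GRing.Theory Num.Theory.

Local Open Scope classical_set_scope.
Local Open Scope ring_scope.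

(** * Quadratic maps *)

Definition polar (G H : zmodType) (f : G -> H) (x y : G) : H :=
  f (x + y) - f x - f y.

(** Polarizations are symmetric, so additivity on one side already gives bilinearity. No homogeneity
    is imposed, so additive maps count as quadratic. *)
Definition quadratic (G H : zmodType) (f : G -> H) : Prop :=
  forall x y z, polar f (x + y) z = polar f x z + polar f y z.

Section Quadratic.
Variables (G H : zmodType) (f : G -> H).

Lemma polarE x y : f (x + y) = f x + f y + polar f x y.
Proof. by rewrite /polar -[f (x + y) - _ - _]addrA -opprD [RHS]addrC subrK. Qed.

Lemma polarC x y : polar f x y = polar f y x.
Proof. by rewrite /polar [x + y]addrC addrAC. Qed.

Hypothesis fQ : quadratic f.

Lemma polar0l z : polar f 0 z = 0.
Proof. by apply: (@addrI _ (polar f 0 z)); rewrite -fQ !addr0. Qed.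

Lemma quadratic0 : f 0 = 0.
Proof.
have /eqP := polar0l 0; rewrite /polar addr0 subrr sub0r oppr_eq0.
by move=> /eqP.
Qed.

Lemma polarNl x z : polar f (- x) z = - polar f x z.
Proof. by apply/eqP; rewrite -addr_eq0 -fQ addNr polar0l. Qed.

Lemma polarMnl x z n : polar f (x *+ n) z = polar f x z *+ n.
Proof. by elim: n => [|n IHn]; rewrite ?polar0l// !mulrS fQ IHn. Qed.

Lemma polarMzl x z (m : int) : polar f (x *~ m) z = polar f x z *~ m.
Proof. by case: m => n; rewrite ?NegzE ?mulrNz ?polarNl -!pmulrn polarMnl. Qed.

Lemma polarDr x y z : polar f z (x + y) = polar f z x + polar f z y.
Proof. by rewrite !(polarC z). Qed.

Lemma polarMzr x z (m : int) : polar f z (x *~ m) = polar f z x *~ m.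
Proof. by rewrite !(polarC z) polarMzl. Qed.

(** The induction produces for [c] the binomial coefficient n(n - 1)/2; only its existence matters
    later. *)
Lemma quadraticMn x n :
  exists c : int, f (x *+ n) = f x *+ n + polar f x x *~ c.
Proof.
elim: n => [|n [c IHn]]; first by exists 0; rewrite quadratic0 mulr0n addr0.
exists (c + n%:Z); rewrite mulrSr polarE IHn polarMnl mulrzDr -pmulrn mulrSr.
by rewrite [RHS]addrA; congr (_ + _); rewrite addrAC.
Qed.

Lemma quadraticN x : f (- x) = polar f x x - f x.
Proof.
have := polarE x (- x); rewrite subrr quadratic0 (polarC x) polarNl => /esym/eqP.
by rewrite subr_eq0 => /eqP <-; rewrite addrC addKr.
Qed.

Lemma quadraticMz x (m : int) :
  exists c : int, f (x *~ m) = f x *~ m + polar f x x *~ c.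
Proof.
case: m => n; first by have [c ?] := quadraticMn x n; exists c.
(* With N = [n.+1], f(-Nx) is the polarization of Nx with itself, which is N^2 times that of x,
   minus f(Nx). *)
have [c fx] := quadraticMn x n.+1; exists (n.+1%:Z * n.+1%:Z - c).
rewrite NegzE !mulrNz -!pmulrn quadraticN fx polarMnl polarC polarMnl.
by rewrite opprD addrCA mulrzBr mulrzA.
Qed.

End Quadratic.

Lemma polar_additive (G H : zmodType) (f : {additive G -> H}) x y :
  polar f x y = 0.
Proof. by rewrite /polar raddfD addrAC addrK subrr. Qed.

Lemma quadratic_additive (G H : zmodType) (f : {additive G -> H}) :
  quadratic f.
Proof. by move=> x y z; rewrite !polar_additive addr0. Qed.

(** The middle clause says that the values of [delta] generate [Q], which makes [phi] in the last
    clause unique. *)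
Definition universal_quadratic (G Q : zmodType) (delta : G -> Q) : Prop :=
  [/\ quadratic delta,
      forall P : Q -> Prop, (forall x y, P x -> P y -> P (x - y)) ->
        (forall p, P (delta p)) -> forall q, P q
    & forall (H : zmodType) (f : G -> H), quadratic f ->
        exists phi : {additive Q -> H}, forall p, phi (delta p) = f p].

Lemma polar_comp (G H K : zmodType) (f : G -> H) (phi : {additive H -> K}) x y :
  polar (phi \o f) x y = phi (polar f x y).
Proof. by rewrite /polar !raddfB. Qed.

Lemma quadratic_comp (G H K : zmodType) (phi : {additive H -> K}) (f : G -> H) :
  quadratic f -> quadratic (phi \o f).
Proof. by move=> fQ x y z; rewrite !polar_comp fQ raddfD. Qed.

(** Presents [G] as Z^2 modulo dZ x d'Z, so that maps out of [G] can be given by periodic formulas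
    in integer coordinates. *)
Definition cyclic_basis (G : zmodType) (d d' : nat) (x y : G) : Prop :=
  (forall z, exists a b : int, z = x *~ a + y *~ b) /\
  (forall a b : int, x *~ a + y *~ b = 0 <-> (d %| a)%Z /\ (d' %| b)%Z).

Section CyclicBasis.
Variables (G : zmodType) (d d' : nat) (g1 g2 : G).
Hypotheses (basis : cyclic_basis d d' g1 g2).

(** Periodicity makes [q] independent of the chosen coordinates, so sums of chosen coordinates can
    serve as coordinates of sums. *)
Lemma quadratic_descent (H : zmodType) (q : int -> int -> H) :
  quadratic (fun u : int * int => q u.1 u.2) ->
  (forall a b a' b', (d %| a' - a)%Z -> (d' %| b' - b)%Z -> q a' b' = q a b) ->
  exists2 f : G -> H, quadratic f & forall a b, f (g1 *~ a + g2 *~ b) = q a b.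
Proof.
move=> qQ q_period; have [gen rel] := basis.
have gen2 z : exists u : int * int, z = g1 *~ u.1 + g2 *~ u.2.
  by have [a [b ->]] := gen z; exists (a, b).
have [c cE] := choice gen2.
have qE z a b : z = g1 *~ a + g2 *~ b -> q (c z).1 (c z).2 = q a b.
  move=> zE; have [] := (rel ((c z).1 - a) ((c z).2 - b)).1.
    by rewrite !mulrzBr addrACA -opprD -cE -zE subrr.
  exact: q_period.
exists (fun z => q (c z).1 (c z).2) => [x y z|a b]; last exact: qE.
have D2 u v : u + v = g1 *~ ((c u).1 + (c v).1) + g2 *~ ((c u).2 + (c v).2).
  by rewrite !mulrzDr addrACA -!cE.
have D3 u v w : u + v + w = g1 *~ ((c u).1 + (c v).1 + (c w).1)
                          + g2 *~ ((c u).2 + (c v).2 + (c w).2).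
  by rewrite [g1 *~ _]mulrzDr [g2 *~ _]mulrzDr addrACA -D2 -cE.
have := qQ (c x) (c y) (c z).
by rewrite /polar /= (qE _ _ _ (D3 x y z)) !(qE _ _ _ (D2 _ _)).
Qed.

Lemma basis_order : g1 *~ d = 0 /\ g2 *~ d' = 0.
Proof.
have [_ rel] := basis; split.
  by have := (rel d 0).2; rewrite mulr0z addr0; apply; rewrite dvdz0 dvdzz.
by have := (rel 0 d').2; rewrite mulr0z add0r; apply; rewrite dvdz0 dvdzz.
Qed.

End CyclicBasis.

(** * Quadratic maps on Z/d x Z/d' *)

Definition zclass (m : nat) (a : int) : Zmod m := \pi_(Zmod m)%qT a.

Lemma zclass_is_zmod_morphism m : zmod_morphism (@zclass m).
Proof. by move=> a b; rewrite /zclass raddfB. Qed.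

HB.instance Definition _ m :=
  GRing.isZmodMorphism.Build _ _ (@zclass m) (@zclass_is_zmod_morphism m).

Lemma zclass_eq0 m a : zclass m a = 0 <-> (m %| a)%Z.
Proof.
rewrite -[a in (_ %| a)%Z]subr0 Quotient.idealrBE.
rewrite -/(zclass m a) -/(zclass m 0) raddf0.
by split=> /eqP.
Qed.

Lemma zclass_eq m a b : zclass m a = zclass m b <-> (m %| a - b)%Z.
Proof.
split=> [ab|/zclass_eq0/eqP]; first by apply/zclass_eq0; rewrite raddfB /= ab subrr.
by rewrite raddfB /= subr_eq0 => /eqP.
Qed.

Lemma zclassP m (z : Zmod m) : exists a, z = zclass m a.
Proof. by elim/quotP: z => a _; exists a. Qed.

Lemma mulrz_mod (H : zmodType) (x y : H) (m u a : int) :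
  x *~ m = y *~ u -> x *~ a = x *~ (a %% m)%Z + y *~ (u * (a %/ m)%Z).
Proof.
move=> xy; rewrite [in LHS](divz_eq a m) mulrzDr addrC; congr (_ + _).
by rewrite mulrC !mulrzA xy.
Qed.

Lemma ord_modz m (a : int) : (0 < m)%N -> exists i : 'I_m, (a %% m)%Z = i.
Proof.
move=> m_gt0; have am : (`|(a %% m)%Z| < m)%N by lia.
by exists (Ordinal am); rewrite /=; lia.
Qed.

Lemma ord_dvdz_eq m (i j : 'I_m) : (m %| i%:Z - j%:Z)%Z -> i = j.
Proof.
by rewrite -eqz_mod_dvd => /eqP; rewrite !modz_nat !modn_small// => -[/val_inj].
Qed.

(* The polarization of a (a + m) at (1, 1) is 2, of order exactly m in Z/2m;
   a^2 itself is not m-periodic modulo 2m when m is odd. *)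
Lemma square_period (m : nat) (a b : int) : (m %| b - a)%Z ->
  zclass (2 * m) (b * (b + m)) = zclass (2 * m) (a * (a + m)).
Proof.
move=> /dvdzP[k ba]; apply/zclass_eq.
have -> : b = a + k * m by rewrite -ba addrC subrK.
suff [l kl] : exists l : int, k * (k + 1) = l * 2.
  apply/dvdzP; exists (a * k + m%:Z * l); rewrite PoszM.
  transitivity (2 * m%:Z * (a * k) + m%:Z * m%:Z * (k * (k + 1))); first by ring.
  by rewrite kl; ring.
have [l [kl|kl]] : exists l, k = 2 * l \/ k = 2 * l + 1 by exists (k %/ 2)%Z; lia.
  by exists (l * (k + 1)); rewrite {1}kl; ring.
by exists (k * (l + 1)); rewrite {2}kl; ring.
Qed.

(** * Normal form for elements of the universal group *)

Section Coordinates.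
Variables (G Q : zmodType) (delta : G -> Q) (d d' : nat) (g1 g2 : G).
Hypotheses (basis : cyclic_basis d d' g1 g2) (univ : universal_quadratic delta).
Hypothesis dvd_dd' : (d %| d')%N.

(** The formulas a(a + d) mod 2d, ab mod d and b(b + d') mod 2d' on Z^2 descend to quadratic maps on
    [G] and factor through [delta]. Each detects exactly one of the three polarizations, and 2 has
    order d in Z/2d and d' in Z/2d'. *)
Lemma polar_coordinates :
  [/\ exists phi : {additive Q -> Zmod (2 * d)},
        [/\ phi (polar delta g1 g1) = zclass _ 2,
            phi (polar delta g1 g2) = 0 & phi (polar delta g2 g2) = 0],
      exists phi : {additive Q -> Zmod d},
        [/\ phi (polar delta g1 g1) = 0,
            phi (polar delta g1 g2) = zclass _ 1 & phi (polar delta g2 g2) = 0]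
    & exists phi : {additive Q -> Zmod (2 * d')},
        [/\ phi (polar delta g1 g1) = 0,
            phi (polar delta g1 g2) = 0 & phi (polar delta g2 g2) = zclass _ 2]].
Proof.
have [_ _ ext] := univ.
have polarZ (H : zmodType) (q : int -> int -> H) (f : G -> H)
    (phi : {additive Q -> H}) :
    (forall p, phi (delta p) = f p) ->
    (forall a b, f (g1 *~ a + g2 *~ b) = q a b) ->
  [/\ phi (polar delta g1 g1) = q 2 0 - q 1 0 - q 1 0,
      phi (polar delta g1 g2) = q 1 1 - q 1 0 - q 0 1
    & phi (polar delta g2 g2) = q 0 2 - q 0 1 - q 0 1].
  move=> phiE fE; rewrite /polar !raddfB !phiE -!fE.
  by rewrite !mulr1z !mulr0z !addr0 !add0r.
have push m (q : int -> int -> int) :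
    quadratic (fun u : int * int => q u.1 u.2) ->
    quadratic (fun u : int * int => zclass m (q u.1 u.2)).
  exact: (quadratic_comp (zclass m)).
split.
- have [||f fQ fE] := quadratic_descent basis
      (q := fun a b => zclass (2 * d) (a * (a + d))).
  + by apply: (push _ (fun a b => a * (a + d))) => -[a b] [a' b'] [a'' b''];
      rewrite /polar /=; ring.
  + by move=> a b a' b' da _; exact: square_period.
  have [phi phiE] := ext _ f fQ; exists phi.
  have [-> -> ->] := polarZ _ _ _ _ phiE fE.
  rewrite -!raddfB; split; rewrite -?[0 in RHS](raddf0 (@zclass (2 * d))) /=;
    by congr zclass; ring.
- have [||f fQ fE] := quadratic_descent basis
      (q := fun a b => zclass d (a * b)).
  + by apply: (push _ (fun a b => a * b)) => -[a b] [a' b'] [a'' b''];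
      rewrite /polar /=; ring.
  + move=> a b a' b' /dvdzP[k ka] db; apply/zclass_eq.
    rewrite (_ : _ - _ = (a' - a) * b' + a * (b' - b)); last by ring.
    apply: rpredD; first by rewrite ka -mulrA mulrCA dvdz_mulr.
    by rewrite dvdz_mull//; exact: dvdz_trans db.
  have [phi phiE] := ext _ f fQ; exists phi.
  have [-> -> ->] := polarZ _ _ _ _ phiE fE.
  rewrite -!raddfB; split; rewrite -?[0 in RHS](raddf0 (@zclass d)) /=;
    by congr zclass; ring.
- have [||f fQ fE] := quadratic_descent basis
      (q := fun a b => zclass (2 * d') (b * (b + d'))).
  + by apply: (push _ (fun a b => b * (b + d'))) => -[a b] [a' b'] [a'' b''];
      rewrite /polar /=; ring.
  + by move=> a b a' b' _ db; exact: square_period.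
  have [phi phiE] := ext _ f fQ; exists phi.
  have [-> -> ->] := polarZ _ _ _ _ phiE fE.
  rewrite -!raddfB; split; rewrite -?[0 in RHS](raddf0 (@zclass (2 * d'))) /=;
    by congr zclass; ring.
Qed.

Hypotheses (d_gt0 : (0 < d)%N) (d'_gt0 : (0 < d')%N).

Definition combination (a b c e f : int) : Q :=
  delta g1 *~ a + delta g2 *~ b + polar delta g1 g1 *~ c
  + polar delta g1 g2 *~ e + polar delta g2 g2 *~ f.

Lemma combinationB a b c e f a' b' c' e' f' :
  combination a b c e f - combination a' b' c' e' f' =
  combination (a - a') (b - b') (c - c') (e - e') (f - f').
Proof.
by rewrite /combination !mulrzBr !opprD; do ![rewrite addrACA; congr (_ + _)].
Qed.

Lemma combinationP q : exists a b c e f, q = combination a b c e f.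
Proof.
have [deltaQ ind _] := univ; elim/ind: q => [x y|p].
  move=> [a [b [c [e [f ->]]]]] [a' [b' [c' [e' [f' ->]]]]].
  by rewrite combinationB; do 5!eexists.
have [a [b ->]] := basis.1 p.
have [c ac] := quadraticMz deltaQ g1 a; have [f bf] := quadraticMz deltaQ g2 b.
exists a, b, c, (b * a), f; rewrite polarE polarMzl// polarMzr// ac bf.
by rewrite /combination mulrzA; exact: (+%R.[AC (2*2*1) (1*3*2*5*4)]).
Qed.

Definition box := ('I_d * 'I_d' * 'I_d * 'I_d * 'I_d')%type.

Definition box_combination (t : box) : Q :=
  let: (a, b, c, e, f) := t in combination a b c e f.

(** The additive extension of the identity of [G] kills polarizations and returns a g1 + b g2. The
    other coefficients are controlled only when a = b = 0, since d times [delta g1] may be a nonzero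
    multiple of [polar delta g1 g1]. *)
Lemma combination_eq0 a b c e f : combination a b c e f = 0 ->
  [/\ (d %| a)%Z, (d' %| b)%Z & a = 0 -> b = 0 ->
    [/\ (d %| c)%Z, (d %| e)%Z & (d' %| f)%Z]].
Proof.
move=> comb0; have [_ _ ext] := univ.
have [phi phiE] := ext _ _ (@quadratic_additive _ _ (@idfun G)).
have [] := (basis.2 a b).1.
  rewrite -[RHS](raddf0 phi) -comb0 /combination !raddfD !raddfMz !phiE.
  rewrite -!polar_comp (_ : phi \o delta = idfun); last exact/funext.
  by rewrite !polar_additive !mul0rz !addr0.
split=> // aE bE; move: comb0; rewrite /combination aE bE !mulr0z !add0r => comb0.
have [[phi1 [u1 v1 w1]] [phi2 [u2 v2 w2]] [phi3 [u3 v3 w3]]] := polar_coordinates.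
have := congr1 phi1 comb0; have := congr1 phi2 comb0; have := congr1 phi3 comb0.
rewrite !raddf0 !raddfD !raddfMz /= u1 v1 w1 u2 v2 w2 u3 v3 w3.
rewrite !mul0rz !addr0 !add0r -!raddfMz /=.
move=> /zclass_eq0 f0 /zclass_eq0 e0 /zclass_eq0 c0.
(* The outer coordinates give 2d | 2c and 2d' | 2f; the factor 2 cancels. *)
by move: f0 e0 c0; rewrite -!(mulrzr 2) !intz !PoszM !dvdz_mul2l.
Qed.

Lemma box_bijective : set_bij [set: box] [set: Q] box_combination.
Proof.
have [d0 d0'] := basis_order basis; have [deltaQ _ _] := univ.
split=> // [[[[[a b] c] e] f] [[[[a' b'] c'] e'] f'] _ _ /=|q _].
  move/eqP; rewrite -subr_eq0 combinationB => /eqP/combination_eq0[].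
  move=> /ord_dvdz_eq <- /ord_dvdz_eq <-; rewrite !subrr => -[]// h1 h2 h3.
  by rewrite (ord_dvdz_eq h1) (ord_dvdz_eq h2) (ord_dvdz_eq h3).
have torsion g m : g *~ m%:Z = 0 -> exists u, delta g *~ m = polar delta g g *~ u.
  have [u mu] := quadraticMz deltaQ g m; move=> gm; exists (- u).
  by apply/eqP; rewrite mulrNz -addr_eq0 -mu gm (quadratic0 deltaQ).
(* Written with [0 *~ 0] to fit [mulrz_mod], whose carry then vanishes. *)
have torsion2 g h m : g *~ m%:Z = 0 -> polar delta g h *~ m = 0 *~ 0.
  by move=> gm; rewrite -polarMzl// gm polar0l.
have [a [b [c [e [f ->]]]]] := combinationP q.
have [u1 t1] := torsion _ _ d0; have [u2 t2] := torsion _ _ d0'.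
rewrite /combination (mulrz_mod a t1) (mulrz_mod b t2).
(* Reducing [a] mod d and [b] mod d' carries into the coefficients of the two self-polarizations,
   which are afterwards reduced without any carry. *)
pose c1 := c + u1 * (a %/ d)%Z; pose f1 := f + u2 * (b %/ d')%Z.
have [i1 j1] := ord_modz a d_gt0; have [i2 j2] := ord_modz b d'_gt0.
have [i3 j3] := ord_modz c1 d_gt0; have [i4 j4] := ord_modz e d_gt0.
have [i5 j5] := ord_modz f1 d'_gt0.
exists (i1, i2, i3, i4, i5) => //.
rewrite /= /combination -j1 -j2 -j3 -j4 -j5.
have modE g h m k : g *~ m%:Z = 0 ->
    polar delta g h *~ k = polar delta g h *~ (k %% m)%Z.
  by move=> /(torsion2 _ h) /(mulrz_mod k) ->; rewrite mul0rz addr0.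
rewrite -!modE// !mulrzDr; exact: (+%R.[AC (1*1*2*1*2) ((1*4)*(2*7)*3*5*6)]).
Qed.

End Coordinates.

(** * Duals *)

Section DualMaps.
Variables (R : realType).
Implicit Types H K : zmodType.

Lemma dual0 H (chi : dual R H) : chi 0 = 1.
Proof. by apply: (mulfI (dual_neq0 chi 0)); rewrite -dualD addr0 mulr1. Qed.

Lemma dualN H (chi : dual R H) x : chi (- x) = (chi x)^-1.
Proof.
by apply: (mulfI (dual_neq0 chi x)); rewrite -dualD subrr dual0 mulfV ?dual_neq0.
Qed.

Lemma dualMz H (chi : dual R H) x (m : int) : chi (x *~ m) = chi x ^ m.
Proof.
have chiMn n : chi (x *+ n) = chi x ^+ n.
  by elim: n => [|n IHn]; rewrite ?dual0// mulrS dualD IHn exprS.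
by case: m => n; rewrite ?NegzE ?mulrNz ?dualN -pmulrn chiMn.
Qed.

Definition dual_comp H K (phi : {additive H -> K}) (chi : dual R K) : dual R H.
Proof.
exists (chi \o phi) => [x|x y] /=; first exact: dual_neq0.
by rewrite raddfD dualD.
Defined.

Lemma dual_compM H K (phi : {additive H -> K}) :
  {morph @dual_comp H K phi : x y / (x * y)%g}.
Proof. by move=> x y; exact: dualP. Qed.

HB.instance Definition _ H K (phi : {additive H -> K}) :=
  isMultiplicative.Build _ _ (dual_comp phi) (dual_compM phi).

Lemma zmod_dual (m : nat) (r : R[i]) : (0 < m)%N -> r ^+ m = 1 ->
  exists chi : dual R (Zmod m), forall a, chi (zclass m a) = r ^ a.
Proof.
move=> m_gt0 rm.
have r0 : r != 0.
  by apply/eqP => r0; move/eqP: rm; rewrite r0 expr0n gtn_eqF// eq_sym oner_eq0.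
have [c cE] := choice (@zclassP m).
have rE a : r ^ (c (zclass m a)) = r ^ a.
  have /zclass_eq/dvdzP[k ca] := esym (cE (zclass m a)).
  rewrite -[c _](subrK a) ca expfzDr// [k * _]mulrC -exprz_exp -exprnP rm.
  by rewrite exp1rz mul1r.
have neq0 z : r ^ (c z) != 0 by rewrite expfz_neq0.
have D x y : r ^ (c (x + y)) = r ^ (c x) * r ^ (c y).
  by rewrite {1}(cE x) {1}(cE y) -raddfD rE expfzDr.
by exists (Dual neq0 D).
Qed.

Lemma dual_ext2 (G : zmodType) (d d' : nat) (g1 g2 : G) (chi psi : dual R G) :
  cyclic_basis d d' g1 g2 -> chi g1 = psi g1 -> chi g2 = psi g2 -> chi =1 psi.
Proof.
by move=> [gen _] e1 e2 z; have [a [b ->]] := gen z; rewrite !dualD !dualMz e1 e2.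
Qed.

Lemma zmod_dual_ext (m : nat) (chi psi : dual R (Zmod m)) :
  chi (zclass m 1) = psi (zclass m 1) -> chi =1 psi.
Proof.
by move=> e z; have [a ->] := zclassP z; rewrite -[a]intz raddfMz !dualMz e.
Qed.

End DualMaps.

(** * The exact sequence of dual groups *)

Section Extension.
Variables (R : realType).
Variables (G Q : zmodType) (delta : G -> Q) (d d' : nat) (g1 g2 : G).
Hypotheses (basis : cyclic_basis d d' g1 g2) (univ : universal_quadratic delta).
Hypothesis dvd_dd' : (d %| d')%N.
Hypotheses (d_gt0 : (0 < d)%N) (d'_gt0 : (0 < d')%N).
Variable j : {additive Zmod d -> G}.
Hypothesis j1 : j (zclass d 1) = g1.

Lemma dual_ext (chi psi : dual R Q) :
  (forall p, chi (delta p) = psi (delta p)) -> chi = psi.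
Proof.
move=> e; apply: dualP => q; have [_ ind _] := univ.
elim/ind: q => // x y xE yE; by rewrite !dualD !dualN xE yE.
Qed.

(** The character is a product of three, one pulled back along each map of [polar_coordinates];
    complex square roots compensate for the values 2. *)
Lemma dual_polar_surjective (s t u : R[i]) :
  s ^+ d = 1 -> t ^+ d = 1 -> u ^+ d' = 1 ->
  exists chi : dual R Q, [/\ chi (polar delta g1 g1) = s,
    chi (polar delta g1 g2) = t & chi (polar delta g2 g2) = u].
Proof.
move=> sd td ud.
have [[phi1 [u1 v1 w1]] [phi2 [u2 v2 w2]] [phi3 [u3 v3 w3]]] :=
  polar_coordinates basis univ dvd_dd'.
(* The first and third coordinates take the value 2 in Z/2d and Z/2d'. *)
have [||c1 c1E] := @zmod_dual R (2 * d) (sqrtC s);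
  rewrite ?muln_gt0// ?exprM ?sqrtCK//.
have [//|//|c2 c2E] := @zmod_dual R d t.
have [||c3 c3E] := @zmod_dual R (2 * d') (sqrtC u);
  rewrite ?muln_gt0// ?exprM ?sqrtCK//.
exists (dual_comp phi1 c1 * dual_comp phi2 c2 * dual_comp phi3 c3)%g.
rewrite /= u1 v1 w1 u2 v2 w2 u3 v3 w3 !dual0 c1E c2E c3E.
by rewrite !mul1r !mulr1 expr1z -!exprnP !sqrtCK.
Qed.

(** Characters of [Q] are multiplicative quadratic maps on [G]. The polarization is recorded by its
    pairing with [g2] on all of [G] and with [g1] on the cyclic factor [Zmod d], reached through
    [j]; the value at (g1, g2) is thus counted once. *)
Lemma quadratic_dual_extension :
  extension (dual R G) (dual R Q) (dual R G * dual R (Zmod d))%type.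
Proof.
have [deltaQ _ ext] := univ.
(* [eta] undoes [delta]; composition with it is the injection of the extension. *)
have [eta etaE] := ext _ _ (@quadratic_additive _ _ (@idfun G)).
have pol2_zmod : zmod_morphism (polar delta ^~ g2).
  by move=> x y; rewrite deltaQ polarNl.
have pol1_zmod : zmod_morphism (fun z => polar delta (j z) g1).
  by move=> x y; rewrite raddfB deltaQ polarNl.
pose pol2 : {additive G -> Q} :=
  HB.pack (polar delta ^~ g2) (GRing.isZmodMorphism.Build _ _ _ pol2_zmod).
pose pol1 : {additive Zmod d -> Q} :=
  HB.pack (fun z => polar delta (j z) g1)
    (GRing.isZmodMorphism.Build _ _ _ pol1_zmod).
pose g y : dual R G * dual R (Zmod d) := (dual_comp pol2 y, dual_comp pol1 y).
have gM : {morph g : x y / (x * y)%g}.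
  by move=> x y; congr pair; exact: dual_compM.
pose gm : {multiplicative dual R Q -> (dual R G * dual R (Zmod d))%type} :=
  HB.pack g (isMultiplicative.Build _ _ _ gM).
exists (dual_comp eta), gm; split=> [chi psi e|y|[chi psi]].
- apply: dualP => p; move/(congr1 (fun c => dual_fun c (delta p))): e => /=.
  by rewrite !etaE.
- split=> [gy1|[x <-]].
    (* Trivial pairings with [g2], and of [g1] with itself, make the whole polarization trivial by
       bilinearity, so [y \o delta] is a character of [G]. *)
    have e2 p : y (polar delta p g2) = 1 := congr1 (fun u => dual_fun u.1 p) gy1.
    have := congr1 (fun u => dual_fun u.2 (zclass d 1)) gy1; rewrite /= j1 => e1.
    have y_polar1 p : y (polar delta p g1) = 1.
      have [a [b ->]] := basis.1 p; rewrite deltaQ !polarMzl// dualD !dualMz.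
      by rewrite e1 (polarC _ g2 g1) e2 !exp1rz mulr1.
    have y_polar p q : y (polar delta p q) = 1.
      have [a [b ->]] := basis.1 q; rewrite polarDr// !polarMzr// dualD !dualMz.
      by rewrite y_polar1 e2 !exp1rz mulr1.
    have D p q : (y \o delta) (p + q) = (y \o delta) p * (y \o delta) q.
      by rewrite /= polarE dualD y_polar dualD mulr1.
    exists (Dual (fun p => dual_neq0 y (delta p)) D).
    by apply: dual_ext => p; rewrite /= etaE.
  have eta_polar p q : eta (polar delta p q) = 0.
    rewrite -polar_comp (_ : eta \o delta = idfun) ?polar_additive//.
    exact/funext.
  by congr pair; apply: dualP => p /=; rewrite eta_polar dual0.
- have [d0 d0'] := basis_order basis.
  (* The prescribed values are roots of unity of the required orders, because d kills [zclass d 1]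
     and [g1], and d' kills [g2]. *)
  have [|||y [y11 y12 y22]] :=
      @dual_polar_surjective (psi (zclass d 1)) (chi g1) (chi g2).
  + rewrite exprnP -dualMz -raddfMz intz (_ : _ d%:Z = 0) ?dual0//.
    exact/zclass_eq0.
  + by rewrite exprnP -dualMz d0 dual0.
  + by rewrite exprnP -dualMz d0' dual0.
  exists y; congr pair; apply: dualP.
    exact: dual_ext2 basis _ _.
  by apply: zmod_dual_ext; rewrite /= j1.
Qed.

End Extension.

(** * The lattice M'/M of the torus *)

Section DifferenceCriterion.
Variables (G H : zmodType) (f : G -> H).

Let D v s : H := f (s + v) - f s.

(** Constancy of the second difference in the directions [u] and [v], compared with its value at the
    base point 0. *)
Let constant_difference u v := forall s, D v (s + u) - D v s = D v u - D v 0.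

Lemma constant_differenceC u v : constant_difference u v -> constant_difference v u.
Proof.
suff DC s : D u (s + v) - D u s = D v (s + u) - D v s.
  by move=> uv s; rewrite DC uv -[in RHS](add0r v) DC add0r.
by rewrite /D !opprB [s + v + u]addrAC; exact: (+%R.[AC (2*2) (1*4*(3*2))]).
Qed.

(** For fixed [v], the increment of [D v] along x + y is one along y followed by one along x, so the
    admissible directions form a subgroup. *)
Lemma constant_difference_span a b u v :
  constant_difference a v -> constant_difference b v ->
  (exists m n : int, u = a *~ m + b *~ n) -> constant_difference u v.
Proof.
have cD x y : constant_difference x v -> constant_difference y v ->
    constant_difference (x + y) v.
  move=> xv yv.
  have e s : D v (s + (x + y)) - D v s = D v x - D v 0 + (D v y - D v 0).
    rewrite -(xv (s + y)) -(yv s) [RHS]addrA subrK.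
    by rewrite -[s + y + x]addrA [y + x]addrC.
  by move=> s; rewrite e -[in RHS](add0r (x + y)) e.
have c0 : constant_difference 0 v by move=> s; rewrite addr0 !subrr.
have cN x : constant_difference x v -> constant_difference (- x) v.
  move=> xv.
  have e s : D v (s - x) - D v s = - (D v x - D v 0).
    by rewrite -(xv (s - x)) subrK opprB.
  by move=> s; rewrite e -[in RHS](add0r (- x)) e.
have cM x (m : int) : constant_difference x v -> constant_difference (x *~ m) v.
  move=> xv; have cMn n : constant_difference (x *+ n) v.
    by elim: n => [|n IHn]; rewrite ?mulrS//; exact: cD.
  by case: m => n; rewrite ?NegzE ?mulrNz -pmulrn//; exact: cN.
by move=> av bv [m [n ->]]; apply: cD; exact: cM.
Qed.

(** Any two of a, b, c generate, as their sum is zero. Hence a, which is good against b and c, is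
    good against every direction, and likewise b. This supplies the pairs (a, a) and (b, b) that are
    not among the assumptions. *)
Lemma quadratic_of_constant_differences (a b c : G) :
  f 0 = 0 -> a + b + c = 0 ->
  (forall z, exists m n : int, z = a *~ m + b *~ n) ->
  constant_difference a b -> constant_difference b c -> constant_difference a c ->
  quadratic f.
Proof.
move=> f0 abc gen_ab ab bc ac.
have cE : c = - a - b by rewrite -opprD; apply/eqP; rewrite -addr_eq0 addrC abc.
have gen_ac z : exists m n : int, z = a *~ m + c *~ n.
  have [m [n ->]] := gen_ab z; exists (m - n), (- n).
  by rewrite cE -opprD mulNrz mulrNz opprK mulrzDl mulrzBr addrA subrK.
have gen_bc z : exists m n : int, z = b *~ m + c *~ n.
  have [m [n ->]] := gen_ab z; exists (n - m), (- m).
  rewrite cE -opprD mulNrz mulrNz opprK mulrzDl mulrzBr.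
  by rewrite [RHS]addrC -addrA [b *~ m + _]addrC subrK.
have all_a u : constant_difference u a.
  by apply: constant_difference_span (gen_bc u); exact: constant_differenceC.
have all_b u : constant_difference u b.
  by apply: constant_difference_span (gen_ac u) => //; exact: constant_differenceC.
have all u v : constant_difference u v.
  apply: constant_differenceC.
  by apply: constant_difference_span (gen_ab v); exact: constant_differenceC.
have polarD u v : polar f u v = D v u - D v 0.
  by rewrite /polar /D add0r f0 subr0.
by move=> x y z; rewrite !polarD -(all x z y) [y + x]addrC addrA subrK.
Qed.

End DifferenceCriterion.

Lemma sum_ord3 (V : nmodType) (F : 'I_3 -> V) (i j k : 'I_3) :
  i != j -> i != k -> j != k -> \sum_l F l = F i + (F j + F k).
Proof.
move=> ij ik jk; rewrite (bigD1 i)//= (bigD1 j) 1?eq_sym//= (bigD1 k)/=; last first.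
  by rewrite eq_sym ik eq_sym jk.
rewrite big1 ?addr0// => l /andP[/andP[li lj] lk].
by move: i j k l ij ik jk li lj lk; do 4!case=> [[|[|[|]]] ?]//.
Qed.

(** * The presentation of M'/M and its universal property *)

Section TorusLattice.
Variables (R : realType) (Gamma : sublattice R).
Local Notation G := (vert Gamma).
Local Notation t := (vtau Gamma).
Local Notation Q := (M'_mod_M Gamma).

Lemma sum_vtau : \sum_k t k = 0.
Proof.
rewrite -raddf_sum (_ : \sum_k tau R k = 0) ?raddf0//.
apply: val_inj; rewrite raddf_sum !big_ord_recl big_ord0 /= /tau_vec /=.
apply/rowP => i; rewrite !mxE; by case: ifP => _; field.
Qed.

Lemma vtau_span (z : G) : exists c : 'I_3 -> int, z = \sum_k t k *~ c k.
Proof.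
elim/quotP: z => z _; have /asboolP[c zc] := pt_lattice z; exists c.
rewrite (_ : z = \sum_k tau R k *~ c k).
  by rewrite raddf_sum; apply: eq_bigr => k _; rewrite raddfMz.
apply: val_inj; rewrite raddf_sum /= zc; apply: eq_bigr => k _.
by rewrite -[RHS]/(\val (tau R k *~ c k)) raddfMz.
Qed.

Lemma vtau_span2 (i j : 'I_3) : i != j ->
  forall z : G, exists m n : int, z = t i *~ m + t j *~ n.
Proof.
move=> ij z; have [c ->] := vtau_span z.
have [k [ik jk]] : exists k, i != k /\ j != k.
  by move: i j ij; do 2!case=> [[|[|[|]]] ?]//; move=> _;
    (do [by exists ord0 | by exists (lift ord0 ord0) | by exists ord_max]).
have sum3 (F : 'I_3 -> G) := sum_ord3 F ij ik jk.
have /eqP := sum_vtau; rewrite sum3 addrA addrC addr_eq0 => /eqP tk.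
exists (c i - c k), (c j - c k); rewrite sum3 tk.
by rewrite mulNrz mulrzDl !mulrzBr addrA opprD addrACA.
Qed.

Section Evaluation.
Variables (H : zmodType) (f : G -> H) (h : 'I_3 -> H).

Definition evaluation (v : Z3n Gamma) : H :=
  \sum_k h k *~ v.1 k + \sum_p f p *~ v.2 p.

Lemma evaluation_is_zmod_morphism : zmod_morphism evaluation.
Proof.
move=> u v; rewrite /evaluation opprD addrACA -!sumrB.
by congr (_ + _); apply: eq_bigr => i _; rewrite -mulrzBr !ffunE.
Qed.

HB.instance Definition _ :=
  GRing.isZmodMorphism.Build _ _ evaluation evaluation_is_zmod_morphism.

Lemma evaluation_e p : evaluation (e_ p) = f p.
Proof.
rewrite /evaluation big1 ?add0r => [|k _]; last by rewrite ffunE mulr0z.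
rewrite (bigD1 p)//= ffunE eqxx mulr1z big1 ?addr0// => q /negPf qp.
by rewrite ffunE qp mulr0z.
Qed.

Lemma evaluation_epsilon k : evaluation (epsilon Gamma k) = h k.
Proof.
rewrite /evaluation addrC big1 ?add0r => [|p _]; last by rewrite ffunE mulr0z.
rewrite (bigD1 k)//= ffunE eqxx mulr1z big1 ?addr0// => q /negPf qp.
by rewrite ffunE qp mulr0z.
Qed.

Lemma evaluation_A p k : evaluation (A_vec p k) =
  h k + (f p + f (p + t k) - \sum_(i < 3 | i != k) f (p - t i)).
Proof.
have evD u v : evaluation (u + v) = evaluation u + evaluation v := raddfD _ u v.
have evN u : evaluation (- u) = - evaluation u := raddfN _ u.
rewrite /A_vec !evD evN (big_morph _ evD (raddf0 _)).
rewrite evaluation_epsilon !evaluation_e.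
by rewrite !addrA (eq_bigr _ (fun i _ => evaluation_e _)).
Qed.

End Evaluation.

Lemma Z3n_decomposition (u : Z3n Gamma) :
  u = \sum_k epsilon Gamma k *~ u.1 k + \sum_p e_ p *~ u.2 p.
Proof.
have fstD (x y : Z3n Gamma) : (x + y).1 = x.1 + y.1 by [].
have sndD (x y : Z3n Gamma) : (x + y).2 = x.2 + y.2 by [].
have ffunMz (I : finType) (F : {ffun I -> int}) (m : int) i : (F *~ m) i = F i * m.
  case: m => n; rewrite ?NegzE ?mulrNz ?ffunE -pmulrn ffunMnE ?mulrN pmulrn;
    by rewrite -mulrzr intz.
have fstMz (x : Z3n Gamma) (m : int) : (x *~ m).1 = x.1 *~ m
  by exact: (raddfMz fst).
have sndMz (x : Z3n Gamma) (m : int) : (x *~ m).2 = x.2 *~ m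
  by exact: (raddfMz snd).
rewrite [LHS]surjective_pairing [RHS]surjective_pairing fstD sndD.
rewrite !(big_morph fst fstD (erefl _)) !(big_morph snd sndD (erefl _)).
congr pair; apply/ffunP => i; rewrite ffunE !sum_ffunE.
  rewrite [X in _ + X]big1 ?addr0 => [|p _]; last by rewrite fstMz mul0rz ffunE.
  rewrite (bigD1 i)//= big1 ?addr0 => [|k /negPf ki]; rewrite fstMz ffunMz ffunE.
    by rewrite eqxx mul1r.
  by rewrite eq_sym ki mul0r.
rewrite big1 ?add0r => [|p _]; last by rewrite sndMz mul0rz ffunE.
rewrite (bigD1 i)//= big1 ?addr0 => [|k /negPf ki]; rewrite sndMz ffunMz ffunE.
  by rewrite eqxx mul1r.
by rewrite eq_sym ki mul0r.
Qed.

Lemma epsilon_M' k : epsilon Gamma k \in @M'_pred R Gamma.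
Proof. by rewrite inE big1// => p _; rewrite ffunE. Qed.

Lemma e_sub_M' p : e_ p - e_ 0 \in @M'_pred R Gamma.
Proof.
have sum_e q : \sum_r (e_ q).2 r = 1 :> int.
  rewrite (bigD1 q)//= ffunE eqxx big1 ?addr0// => r /negPf rq.
  by rewrite ffunE rq.
rewrite inE (eq_bigr (fun r => (e_ p).2 r - (e_ 0).2 r)) => [|r _].
  by rewrite sumrB !sum_e subrr.
by rewrite !ffunE.
Qed.

Definition M'_class (v : M' Gamma) : Q := \pi_Q%qT v.

Lemma M'_class_is_zmod_morphism : zmod_morphism M'_class.
Proof. by move=> u v; rewrite /M'_class raddfB. Qed.

HB.instance Definition _ :=
  GRing.isZmodMorphism.Build _ _ M'_class M'_class_is_zmod_morphism.

(** Subtracting [e_ 0] puts the vector in [M'] and makes the value at 0 vanish, as it must for a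
    quadratic map. *)
Definition vert_class (p : G) : Q := M'_class (MkM' (e_sub_M' p)).

(** On [M'] the coefficients of the [e_ p] sum to zero, so the corrections by [e_ 0] cancel. *)
Lemma M'_classE v :
  M'_class v = evaluation vert_class (fun k => M'_class (MkM' (epsilon_M' k))) v.
Proof.
have {1}-> : v = \sum_k MkM' (epsilon_M' k) *~ (val v).1 k
               + \sum_p MkM' (e_sub_M' p) *~ (val v).2 p.
  apply: val_inj; rewrite raddfD !raddf_sum /= [LHS]Z3n_decomposition.
  congr (_ + _).
    apply: eq_bigr => k _.
    by rewrite -[RHS]/(\val (MkM' (epsilon_M' k) *~ _)) raddfMz.
  pose g p := e_ p *~ (val v).2 p - e_ 0 *~ (val v).2 p.
  rewrite [RHS](eq_bigr g) => [|p _].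
    rewrite sumrB -[X in _ - X]mulrz_sumr.
    by have := M'_valP v; rewrite inE => /eqP ->; rewrite mulr0z subr0.
  by rewrite /g -[LHS]/(\val (MkM' (e_sub_M' p) *~ _)) raddfMz -mulrzBl.
rewrite raddfD !raddf_sum; congr (_ + _); apply: eq_bigr => i _; exact: raddfMz.
Qed.

Lemma M'_class_eq0 v : M'_class v = 0 <-> v \in @M_pred R Gamma.
Proof.
have := Quotient.idealrBE (@M_pred R Gamma) v 0.
rewrite subr0 -/(M'_class v) -/(M'_class 0) raddf0 => ->.
by split=> /eqP.
Qed.

Lemma M'_classP (q : Q) : exists v, q = M'_class v.
Proof. by elim/quotP: q => v _; exists v. Qed.

Lemma M'_class_A p k : M'_class (A p k) = 0.
Proof.
apply/M'_class_eq0/asboolP; exists (fun q l => ((q == p) && (l == k))%:R).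
rewrite (bigD1 p)//= (bigD1 k)//= !eqxx mulr1z.
rewrite big1 => [|l /negPf ->]; last exact: mulr0z.
by rewrite addr0 big1 ?addr0// => q /negPf ->; rewrite big1// => l _; exact: mulr0z.
Qed.

Lemma M'_class_factor (H : zmodType) (phi : {additive M' Gamma -> H}) :
  (forall p k, phi (A p k) = 0) ->
  exists psi : {additive Q -> H}, forall v, psi (M'_class v) = phi v.
Proof.
move=> phiA; have [c cE] := choice M'_classP.
have phi_c v : phi (c (M'_class v)) = phi v.
  have /eqP := cE (M'_class v); rewrite eq_sym -subr_eq0 -raddfB.
  move=> /eqP/M'_class_eq0/asboolP[m mE]; apply/eqP.
  rewrite -subr_eq0 -raddfB mE raddf_sum big1// => p _.
  by rewrite raddf_sum big1// => k _; rewrite raddfMz phiA mul0rz.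
have psiB : zmod_morphism (phi \o c).
  by move=> x y; rewrite /= {1}(cE x) {1}(cE y) -raddfB phi_c raddfB.
pose psi : {additive Q -> H} :=
  HB.pack (phi \o c) (GRing.isZmodMorphism.Build _ _ _ psiB).
by exists psi.
Qed.

Lemma vert_class0 : vert_class 0 = 0.
Proof.
rewrite /vert_class -(raddf0 M'_class); congr M'_class.
by apply: val_inj; rewrite /= subrr.
Qed.

(** When each term is expanded at [p], the two copies of f(p) cancel, and so do the polarizations,
    since the -t_i with i != k add up to t_k. As the result does not involve [p], one value on
    [epsilon k] can kill all A_{p,k}. *)
Lemma quadratic_evaluation_A (H : zmodType) (f : G -> H) p k : quadratic f ->
  f p + f (p + t k) - \sum_(i < 3 | i != k) f (p - t i) =
  f (t k) - \sum_(i < 3 | i != k) f (- t i).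
Proof.
move=> fQ; rewrite (eq_bigr _ (fun i _ => polarE f p (- t i))) 2!big_split /=.
have tk : \sum_(i < 3 | i != k) - t i = t k.
  have /eqP := sum_vtau; rewrite (bigD1 k)//= addr_eq0 => /eqP ->.
  by rewrite sumrN.
have polarpD x y : polar f p (x + y) = polar f p x + polar f p y by exact: polarDr.
rewrite -(big_morph _ polarpD (etrans (polarC f p 0) (polar0l fQ p))) tk.
rewrite sumr_const cardC1 card_ord (polarE f p (t k)) mulr2n.
set S := \sum_(_ < _ | _) _; apply/eqP; rewrite subr_eq; apply/eqP.
by rewrite [RHS](+%R.[AC (2*4) (3*4*1*6*5*2)]) addrK -!addrA.
Qed.

(** At p = s + t_i + t_j = s - t_k, the relation A_{p,k} = 0 says that the second difference at s in
    the directions t_i, t_j is minus the class of [epsilon k], hence constant in s. *)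
Lemma vert_class_quadratic : quadratic vert_class.
Proof.
have cst p k : vert_class p + vert_class (p + t k)
    - \sum_(i < 3 | i != k) vert_class (p - t i) = - M'_class (MkM' (epsilon_M' k)).
  apply/eqP; rewrite -addr_eq0 addrC.
  rewrite -(evaluation_A _ (fun l => M'_class (MkM' (epsilon_M' l)))).
  by rewrite -(M'_classE (A p k)) M'_class_A.
have DD i j k s : i != j -> i != k -> j != k ->
    vert_class (s + t i + t j) - vert_class (s + t i)
    - (vert_class (s + t j) - vert_class s) = - M'_class (MkM' (epsilon_M' k)).
  move=> ij ik jk; rewrite -(cst (s + t i + t j)).
  have t0 := sum_vtau; rewrite (sum_ord3 _ ij ik jk) in t0.
  have sum2 (F : 'I_3 -> Q) : \sum_(l < 3 | l != k) F l = F i + F j.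
    have := sum_ord3 F ij ik jk; rewrite (bigD1 k)//= addrC addrA.
    exact: addIr.
  rewrite sum2 -!(addrA s) -(addrA (t i)) t0 addr0 addrK.
  rewrite [t i + t j - t i]addrAC subrr add0r opprB opprD.
  exact: (+%R.[AC (2*2) (1*3*(4*2))]).
have sum0 := sum_vtau.
apply: (@quadratic_of_constant_differences _ _ _ (t 0) (t 1) (t 2)).
- exact: vert_class0.
- by move: sum0; rewrite (@sum_ord3 _ _ 0 1 2)// addrA.
- exact: (@vtau_span2 0 1).
- by move=> s; rewrite (DD 0 1 2)// -(DD 0 1 2 0)// !add0r.
- by move=> s; rewrite (DD 1 2 0)// -(DD 1 2 0 0)// !add0r.
- by move=> s; rewrite (DD 0 2 1)// -(DD 0 2 1 0)// !add0r.
Qed.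

Lemma vert_class_universal : universal_quadratic vert_class.
Proof.
split; first exact: vert_class_quadratic.
- move=> P PB Pv q.
  have P0 : P 0 by rewrite -(subrr (vert_class 0)); exact: PB.
  have PN x : P x -> P (- x) by rewrite -[- x]sub0r; exact: PB.
  have PD x y : P x -> P y -> P (x + y).
    by move=> Px /PN Py; rewrite -[y]opprK; exact: PB.
  have PMz x (m : int) : P x -> P (x *~ m).
    move=> Px; have PMn n : P (x *+ n) by elim: n => // n; rewrite mulrS; exact: PD.
    by case: m => n; rewrite ?NegzE ?mulrNz -pmulrn//; exact: PN.
  have Psum (I : finType) (A : pred I) (F : I -> Q) :
      (forall i, A i -> P (F i)) -> P (\sum_(i | A i) F i).
    by move=> PF; elim/big_ind: _.
  have [v ->] := M'_classP q; rewrite M'_classE.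
  apply: (PD _ _); apply: (Psum _ _ _) => i _; apply: (PMz) => //.
  (* The classes of the [epsilon] vectors are generated too: the relation at p = 0 expresses them by
     values of [vert_class]. *)
  have : evaluation vert_class 
      (fun k => M'_class (MkM' (epsilon_M' k))) (A 0 i) = 0.
    by rewrite -M'_classE M'_class_A.
  rewrite evaluation_A => /eqP; rewrite addr_eq0 => /eqP ->.
  by apply/PN/PB; [exact: PD|exact: Psum].
- move=> H f fQ.
  (* This value is forced by A_{p,k} = 0, and the same one serves every [p] by
     [quadratic_evaluation_A]. *)
  pose h k := - (f (t k) - \sum_(i < 3 | i != k) f (- t i)).
  have [|psi psiE] := @M'_class_factor H (evaluation f h \o val).
    by move=> p k; rewrite /= evaluation_A quadratic_evaluation_A// addNr.
  exists psi => p; rewrite psiE /=.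
  rewrite -[LHS]/(evaluation f h (e_ p - e_ 0)) raddfB /= !evaluation_e.
  by rewrite (quadratic0 fQ) subr0.
Qed.

End TorusLattice.

(** * The first elementary divisor *)

(** The quotient by <a> is generated by the coset of b, so the index of <a> is the order of that
    coset. *)
Lemma dvdn_index_cycle (gT : finGroupType) (a b : gT) (k : nat) :
  abelian [set: gT]%G -> (forall z, z \in <[a]> * <[b]>)%g ->
  (b ^+ k \in <[a]>)%g -> (#|gT| %/ #[a]%g %| k)%N.
Proof.
move=> abel gen bk.
have nA (B : {set gT}) : B \subset 'N(<[a]>)%g.
  by apply: cents_norm; apply: (sub_abelian_cent2 abel); exact: finset.subsetT.
have bN : b \in 'N(<[a]>)%g :=
  fintype.subsetP (nA finset.setT) b (finset.in_setT b).
have genE : (<[a]> * <[b]>)%g = [set: gT]%SET.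
  by apply/finset.setP => z; rewrite gen inE.
have <- : #[coset <[a]> b]%g = (#|gT| %/ #[a]%g)%N.
  rewrite orderE -morphim_cycle// -quotientE -quotientMidl genE.
  by rewrite card_quotient// -cardsT -(Lagrange (finset.subsetT <[a]>%G)) mulKn.
rewrite order_dvdn -morphX//=.
by apply/eqP/coset_id.
Qed.

Section FiniteBasis.
Variables (G : finZmodType) (d d' : nat) (g1 g2 : G).
Hypotheses (basis : cyclic_basis d d' g1 g2).

Lemma mulrn_card (x : G) : x *+ #|G| = 0.
Proof. by have := expg_cardG (finset.in_setT x); rewrite cardsT. Qed.

(** The order of [G] kills both generators, so it is a positive multiple of d and of d'. *)
Lemma cyclic_basis_gt0 : (0 < d)%N /\ (0 < d')%N.
Proof.
have [_ rel] := basis; have G_gt0 : (0 < #|G|)%N by apply/card_gt0P; exists 0.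
have [] := (rel #|G| #|G|).1; first by rewrite -!pmulrn !mulrn_card addr0.
by rewrite !dvdzE /= => /dvdn_gt0 -> // /dvdn_gt0 ->.
Qed.

Lemma cyclic_basis_card : #|G| = (d * d')%N.
Proof.
have [d_gt0 d'_gt0] := cyclic_basis_gt0; have [d0 d0'] := basis_order basis.
pose h (u : 'I_d * 'I_d') := g1 *~ u.1%:Z + g2 *~ u.2%:Z.
have mod_d (m : nat) (g : G) k : g *~ m = 0 -> g *~ k = g *~ (k %% m)%Z.
  by move=> gm; rewrite (@mulrz_mod _ g 0 m 0) ?mul0rz ?addr0.
have h_inj : injective h.
  move=> [i j] [i' j'] /eqP; rewrite -subr_eq0 /h /= opprD addrACA -!mulrzBr.
  by move=> /eqP/(basis.2 _ _).1[/ord_dvdz_eq -> /ord_dvdz_eq ->].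
have h_surj z : exists u, h u = z.
  have [a [b ->]] := basis.1 z; have [i iE] := ord_modz a d_gt0.
  have [i' iE'] := ord_modz b d'_gt0; exists (i, i').
  by rewrite /h /= -iE -iE' -!mod_d.
have [c cE] := choice h_surj.
have /bij_eq_card : bijective h by exists c => // u; apply: h_inj.
by rewrite card_prod !card_ord.
Qed.

(** Since d' kills [G], the order of x divides d', so d divides the index d (d'/|x|). Conversely,
    the gcd g divides both coefficients of every relation between a and b, so coordinates with
    respect to a, b make sense modulo g, where d g1 = 0 can be read off. *)
Lemma first_divisor_gcdn (a b : G) : (d %| d')%N ->
  (forall z, exists m n : int, z = a *~ m + b *~ n) ->
  d = gcdn (#|G| %/ #[a]%g)%N (#|G| %/ #[b]%g)%N.
Proof.
move=> dd' gen; have [d_gt0 d'_gt0] := cyclic_basis_gt0.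
have [d0 d0'] := basis_order basis.
have dvd_index (x : G) : (d %| #|G| %/ #[x]%g)%N.
  have xd' : (#[x]%g %| d')%N.
    rewrite order_dvdn; apply/eqP; change (x *+ d' = 0).
    have [m [n ->]] := basis.1 x.
    rewrite pmulrn mulrzDl -!mulrzA ![_ * d'%:Z]mulrC !mulrzA d0'.
    by have /dvdnP[k ->] := dd'; rewrite mulnC PoszM mulrzA d0 !mul0rz addr0.
  by rewrite cyclic_basis_card -muln_divA// dvdn_mulr.
have index_dvd (x y : G) : (forall z, exists m n : int, z = x *~ m + y *~ n) ->
    forall m n : int, x *~ m + y *~ n = 0 -> ((#|G| %/ #[x]%g)%N %| n)%Z.
  move=> gen_xy m n /eqP; rewrite addrC addr_eq0 => /eqP yn.
  have mem_cyclez (u : G) (k : int) : u *~ k \in <[u]>%g.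
    case: k => k; first exact: mem_cycle.
    by rewrite NegzE mulrNz groupV; exact: mem_cycle.
  rewrite dvdzE /=; apply: (@dvdn_index_cycle _ x y).
  - exact: FinRing.zmod_abelian.
  - by move=> z; have [p [q ->]] := gen_xy z; apply: mem_mulg; exact: mem_cyclez.
  - have ynx : y *~ n \in <[x]>%g by rewrite yn groupV.
    case: (n) ynx => k //; rewrite NegzE mulrNz groupV.
    by rewrite abszN.
set g := gcdn _ _; apply/eqP; rewrite eqn_dvd dvdn_gcd !dvd_index /=.
have rel (m n : int) : a *~ m + b *~ n = 0 -> (g %| m)%Z /\ (g %| n)%Z.
  move=> e; split.
    apply: dvdz_trans (index_dvd b a _ n m _); last by rewrite addrC.
      by rewrite dvdzE /=; exact: dvdn_gcdr.
    by move=> z; have [p [q ->]] := gen z; exists q, p; rewrite addrC.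
  apply: dvdz_trans (index_dvd a b gen m n e); rewrite dvdzE /=.
  exact: dvdn_gcdl.
have [x1 [y1 aE]] := basis.1 a; have [x2 [y2 bE]] := basis.1 b.
have [p [q g1E]] := gen g1; have [r [s g2E]] := gen g2.
have comb (x y m n : int) : a *~ m + b *~ n = g1 *~ x + g2 *~ y ->
    (g %| x * p + y * r - m)%Z /\ (g %| x * q + y * s - n)%Z.
  move=> e; apply: rel; rewrite !mulrzBr addrACA -opprD e !mulrzDr addrACA.
  rewrite ![_ * p]mulrC ![_ * q]mulrC ![_ * r]mulrC ![_ * s]mulrC.
  by rewrite !mulrzA -!mulrzDl -g1E -g2E subrr.
have [|i1 i2] := comb x1 y1 1 0; first by rewrite mulr1z mulr0z addr0.
have [|i3 i4] := comb x2 y2 0 1; first by rewrite mulr1z mulr0z add0r.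
have [|i5 i6] := comb d 0 0 0; first by rewrite d0 !mulr0z !addr0.
move: i1 i2 i3 i4 i5 i6; rewrite !mul0r !subr0.
move=> /dvdzP[k1 e1] /dvdzP[k2 e2] /dvdzP[k3 e3].
move=> /dvdzP[k4 e4] /dvdzP[k5 e5] /dvdzP[k6 e6].
suff : (g%:Z %| d%:Z)%Z by [].
(* Let X have rows (x1, y1), (x2, y2) and P rows (p, q), (r, s). Modulo g, XP is the identity and d
   times the first row of P is zero; the witness comes from d = d det(X) det(P) - d (det(XP) -
   1). *)
apply/dvdzP; exists ((x1 * y2 - x2 * y1) * (k5 * s - k6 * r)
  + d%:Z * (k2 * (k3 * g%:Z)) - d%:Z * (k1 + k4 + k1 * (k4 * g%:Z))).
transitivity ((x1 * y2 - x2 * y1) * ((k5 * g%:Z) * s - (k6 * g%:Z) * r)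
  + d%:Z * ((k2 * g%:Z) * (k3 * g%:Z))
  - d%:Z * (k1 * g%:Z + k4 * g%:Z + (k1 * g%:Z) * (k4 * g%:Z))); last by ring.
by rewrite -e1 -e2 -e3 -e4 -e5 -e6; ring.
Qed.

End FiniteBasis.

Lemma first_elementary_divisor_basis (G : finZmodType) (d : nat) :
  first_elementary_divisor G d ->
  exists d' g1 g2, [/\ (d %| d')%N, cyclic_basis d d' g1 g2
    & exists j : {additive Zmod d -> G}, j (zclass d 1) = g1].
Proof.
move=> [d' [dd' [f [f' fK f'K]]]].
pose g1 := f (zclass d 1, 0); pose g2 := f (0, zclass d' 1).
have fE a b : f (zclass d a, zclass d' b) = g1 *~ a + g2 *~ b.
  rewrite -!raddfMz -raddfD; congr (f _).
  have pairMz (x : Zmod d) (y : Zmod d') m : (x, y) *~ m = (x *~ m, y *~ m).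
    by rewrite [LHS]surjective_pairing (raddfMz fst) (raddfMz snd).
  rewrite !pairMz !mul0rz -!raddfMz !intz.
  by congr pair; rewrite /= ?addr0 ?add0r.
exists d', g1, g2; split=> //; first split=> [z|a b].
- have [a aE] := zclassP (f' z).1; have [b bE] := zclassP (f' z).2; exists a, b.
  by rewrite -fE -aE -bE -surjective_pairing f'K.
- rewrite -fE; split=> [f0|[/zclass_eq0 -> /zclass_eq0 ->]]; last exact: raddf0.
  have /(can_inj fK) : f (zclass d a, zclass d' b) = f 0 by rewrite f0 raddf0.
  by case=> /zclass_eq0 ? /zclass_eq0.
- have jB : zmod_morphism (fun x : Zmod d => f (x, 0)).
    by move=> x y; rewrite -raddfB; congr (f _); congr pair; rewrite /= subr0.
  pose j : {additive Zmod d -> G} :=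
    HB.pack (fun x : Zmod d => f (x, 0)) (GRing.isZmodMorphism.Build _ _ _ jB).
  by exists j.
Qed.

Lemma card_bij_finType (X : finType) (T : Type) (f : X -> T) :
  set_bij [set: X] [set: T] f -> ([set: T] #= `I_#|X|)%card.
Proof.
move=> [_ f_inj f_surj].
have f_surj' y : exists x, f x = y by have [x _ fx] := f_surj y I; exists x.
have [h hK] := choice f_surj'.
apply/card_set_bijP; exists (fun y => enum_rank (h y) : nat); split.
- by move=> y _ /=; exact: ltn_ord.
- by move=> y z _ _ /= /val_inj/enum_rank_inj yz; rewrite -(hK y) yz hK.
- move=> k /= kX; exists (f (enum_val (Ordinal kX))) => //.
  have -> : h (f (enum_val (Ordinal kX))) = enum_val (Ordinal kX).
    by apply: f_inj; rewrite ?inE.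
  by rewrite enum_valK.
Qed.

Theorem proposition4p10 (R : realType) (Gamma : sublattice R) (n d : nat)
    (polyT : polyhedral Gamma) (cardT : #|{: vert Gamma}| = n)
    (divd : first_elementary_divisor (vert Gamma) d) :
  [/\ forall i j : 'I_3, i != j ->
        d = gcdn (n %/ #[vtau Gamma i]%g) (n %/ #[vtau Gamma j]%g),
      extension (dual R (vert Gamma))
        (dual R (M'_mod_M Gamma))
        (dual R (vert Gamma) * dual R (Zmod d))%type
    & ([set: M'_mod_M Gamma] #= `I_(n ^ 2 * d)%N)%card].
Proof.
have [d' [g1 [g2 [dd' basis [j j1]]]]] := first_elementary_divisor_basis divd.
have [d_gt0 d'_gt0] := cyclic_basis_gt0 basis.
have univ := vert_class_universal Gamma.
split=> [i k ik||].
- rewrite -cardT; exact: (first_divisor_gcdn basis dd' (vtau_span2 ik)).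
- exact: (quadratic_dual_extension R basis univ dd' d_gt0 d'_gt0 j1).
(* As n = d d', both sides equal d^3 d'^2. *)
have -> : (n ^ 2 * d)%N = #|{: box d d'}|.
  by rewrite !card_prod !card_ord -cardT (cyclic_basis_card basis) -mulnn; lia.
exact: (card_bij_finType (box_bijective basis univ dd' d_gt0 d'_gt0)).
Qed.
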